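(* Let $A$ be a real $n\times d$ matrix of full column rank with nonzero rows $a_1,\dots,a_n$, and let $b\in\mathbb R^n$. Let $D$ be the $n\times n$ diagonal matrix with diagonal entries $d_{j,j}=\|a_j\|_2$, and consider the composite matrix $D^{-1}A$. Set $e_w=D^{-1}(Ax_\star^w-b)$, where $x_\star^w$ is the minimizer of the weighted least squares problem $$x_\star^w=\arg\min_x\tfrac12\|D^{-1}(Ax-b)\|_2^2.$$ Suppose that $0<c<1$. Let $x_0\in\mathbb R^d$ and consider the Kaczmarz iteration $$x_{k+1}=x_k+c\cdot\frac{b_i-\langle a_i,x_k\rangle}{\|a_i\|_2^2}\,a_i,$$ where at each iteration the row index $i$ is drawn independently and uniformly from $\{1,\dots,n\}$. Then the expected error after $k$ iterations satisfies $$\mathbb E\|x_k-x_\star^w\|_2^2\le\left[1-\frac{2c(1-c)}{K(D^{-1}A)}\right]^k\|x_0-x_\star^w\|_2^2+\frac{c}{1-c}K(D^{-1}A)\,r_w,$$ where $r_w=\|e_w\|_2^2/n$.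
   Context: For a matrix $B$ of full column rank, $K(B)=\|B\|_F^2\,\|(B^TB)^{-1}\|_2$, where $\|\cdot\|_F$ is the Frobenius norm and $\|\cdot\|_2$ of a matrix is the spectral norm. *)

(* Defs.v *)
From HB Require Import structures.
From mathcomp Require Import all_boot all_order all_algebra finmap.
From mathcomp Require Import all_classical all_reals all_analysis.

Set Implicit Arguments.
Unset Strict Implicit.
Unset Printing Implicit Defensive.

Import Order.TTheory GRing.Theory Num.Theory.

Local Open Scope classical_set_scope.
Local Open Scope ring_scope.

(* The norm notation `|_| on matrices is the entrywise sup norm, hence the
   explicit Euclidean, Frobenius and spectral norms below. *)

Definition dotv (R : realType) (d : nat) (u v : 'cV[R]_d) : R :=
  \sum_(j < d) u j 0 * v j 0.

Definition l2norm (R : realType) (d : nat) (v : 'cV[R]_d) : R :=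
  Num.sqrt (\sum_(j < d) v j 0 ^+ 2).

Definition frobenius_norm (R : realType) (m d : nat) (B : 'M[R]_(m, d)) : R :=
  Num.sqrt (\sum_(i < m) \sum_(j < d) B i j ^+ 2).

(* Supremum over the closed unit ball rather than the unit sphere, so that the
   set is never empty. *)
Definition spectral_norm (R : realType) (m d : nat) (B : 'M[R]_(m, d)) : R :=
  sup [set l2norm (B *m x) | x in [set x : 'cV[R]_d | l2norm x <= 1]].

Definition cond_K (R : realType) (m d : nat) (B : 'M[R]_(m, d)) : R :=
  frobenius_norm B ^+ 2 * spectral_norm (invmx (B^T *m B)).

Definition rowv (R : realType) (n d : nat) (A : 'M[R]_(n, d)) (i : 'I_n) :
  'cV[R]_d := (row i A)^T.

Definition rownorm_mx (R : realType) (n d : nat) (A : 'M[R]_(n, d)) :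
  'M[R]_n := diag_mx (\row_j l2norm (rowv A j)).

Definition weighted_residual (R : realType) (n d : nat) (A : 'M[R]_(n, d))
    (b : 'cV[R]_n) (x : 'cV[R]_d) : 'cV[R]_n :=
  invmx (rownorm_mx A) *m (A *m x - b).

Definition weighted_ls_objective (R : realType) (n d : nat)
    (A : 'M[R]_(n, d)) (b : 'cV[R]_n) (x : 'cV[R]_d) : R :=
  2^-1 * l2norm (weighted_residual A b x) ^+ 2.

Definition is_minimizer (R : realType) (T : Type) (f : T -> R) (x : T) : Prop :=
  forall y, f x <= f y.

Definition kaczmarz_step (R : realType) (n d : nat) (A : 'M[R]_(n, d))
    (b : 'cV[R]_n) (c : R) (i : 'I_n) (x : 'cV[R]_d) : 'cV[R]_d :=
  x + (c * ((b i 0 - dotv (rowv A i) x) / l2norm (rowv A i) ^+ 2)) *: rowv A i.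

(* [idx j] is the row used to go from the j-th to the (j+1)-st iterate. *)
Fixpoint kaczmarz (R : realType) (n d : nat) (A : 'M[R]_(n, d))
    (b : 'cV[R]_n) (c : R) (x0 : 'cV[R]_d) (idx : nat -> 'I_n) (k : nat) :
    'cV[R]_d :=
  if k is k'.+1
  then kaczmarz_step A b c (idx k') (kaczmarz A b c x0 idx k')
  else x0.

(* Measurable types are pointed in the library, so this needs a nonempty
   ordinal. *)
HB.instance Definition _ (n : nat) := isPointed.Build 'I_n.+1 ord0.

HB.instance Definition _ (n : nat) :=
  @isMeasurable.Build default_measure_display 'I_n.+1 discrete_measurable
    discrete_measurable0 discrete_measurableC discrete_measurableU.

Definition mutually_independent (disp disp' : measure_display)
    (Omega : measurableType disp) (S : measurableType disp') (R : realType)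
    (P : probability Omega R) (I : choiceType) (X : I -> {RV P >-> S}) : Prop :=
  forall (J : {fset I}) (B : I -> set S), (forall i, measurable (B i)) ->
    P (\bigcap_(i in [set` J]) (X i @^-1` B i)) =
    (\prod_(i <- J) P (X i @^-1` B i))%E.

Definition uniformly_distributed (disp : measure_display)
    (Omega : measurableType disp) (R : realType) (P : probability Omega R)
    (n : nat) (X : {RV P >-> 'I_n.+1}) : Prop :=
  forall i : 'I_n.+1, P (X @^-1` [set i]) = (n.+1%:R^-1)%:E.

(* Main.v *)
Require Import Defs.
From HB Require Import structures.
From mathcomp Require Import all_boot all_order all_algebra finmap ring lra.
From mathcomp Require Import all_classical all_reals all_analysis.
From mathcomp Require Import measurable_realfun measurable_fun_approximation.

Set Implicit Arguments.
Unset Strict Implicit.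
Unset Printing Implicit Defensive.

Import Order.TTheory GRing.Theory Num.Theory.

Local Open Scope classical_set_scope.
Local Open Scope ring_scope.

(** Write n for the number of rows, B = D^-1 A, whose rows b_i are unit vectors,
K = K(B), and e = D^-1 (A xw - b) for the residual at the minimizer.  A step along row i from
x = xw + z turns the error z into z - c rho_i b_i, where rho = e + B z is the
normalized residual at x ([kaczmarz_stepE]).  Expanding the square with
|b_i| = 1 and averaging over i yields

  |z|^2 - (2 c / n) <rho, B z> + (c^2 / n) |rho|^2,

and the optimality of xw makes e orthogonal to the range of B
([residual_orthogonal]), so that this is

  |z|^2 - ((2 c - c^2) / n) |B z|^2 + c^2 r_w

([sum_step_error]).  All rows being unit, the squared Frobenius norm of B is n,
and |z|^2 <= ||(B^T B)^-1|| |B z|^2 becomes n |z|^2 <= K |B z|^2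
([cond_K_bound]).  With q = 1 - 2 c (1 - c) / K and C = c / (1 - c) K r_w, where
C (1 - q) = 2 c^2 r_w dominates the noise term c^2 r_w, one step thus contracts
the mean of |z|^2 - C by the factor q ([mean_step_contraction]).

Iterating requires q >= 0, which holds because K >= 1 >= 2 c (1 - c)
([cond_K_ge1]).  Since k independent uniform draws produce every k-tuple of
indices with the same probability, the expectation is a plain average over
k-tuples ([expectation_hist]), and splitting off the first index turns the
one-step contraction into a factor q^k ([sum_kaczmarz_contraction]). *)

(** * Euclidean geometry and the spectral norm *)

Section Euclidean.
Variables (R : realType).
Implicit Types (m d : nat).

Lemma dotvC d (u v : 'cV[R]_d) : dotv u v = dotv v u.
Proof. by apply: eq_bigr => j _; rewrite mulrC. Qed.

Lemma dotvDl d (u v w : 'cV[R]_d) : dotv (u + v) w = dotv u w + dotv v w.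
Proof. by rewrite -big_split; apply: eq_bigr => j _; rewrite !mxE mulrDl. Qed.

Lemma dotvZl d (a : R) (u v : 'cV[R]_d) : dotv (a *: u) v = a * dotv u v.
Proof. by rewrite mulr_sumr; apply: eq_bigr => j _; rewrite !mxE mulrA. Qed.

Lemma dotvDr d (u v w : 'cV[R]_d) : dotv w (u + v) = dotv w u + dotv w v.
Proof. by rewrite dotvC dotvDl !(dotvC w). Qed.

Lemma dotvZr d (a : R) (u v : 'cV[R]_d) : dotv v (a *: u) = a * dotv v u.
Proof. by rewrite dotvC dotvZl dotvC. Qed.

Lemma dotvv_ge0 d (v : 'cV[R]_d) : 0 <= dotv v v.
Proof. by apply: sumr_ge0 => j _; rewrite -expr2 sqr_ge0. Qed.

Lemma dotvv_eq0 d (v : 'cV[R]_d) : (dotv v v == 0) = (v == 0).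
Proof.
apply/idP/eqP => [|->]; last first.
  by rewrite /dotv big1 // => j _; rewrite mxE mul0r.
rewrite psumr_eq0 => [/allP v0|j _]; last by rewrite -expr2 sqr_ge0.
apply/colP => j; rewrite mxE; apply/eqP.
by have := v0 j (mem_index_enum _); rewrite /= mulf_eq0 orbb.
Qed.

Lemma dotvv_gt0 d (v : 'cV[R]_d) : (0 < dotv v v) = (v != 0).
Proof. by rewrite lt_neqAle dotvv_ge0 andbT eq_sym dotvv_eq0. Qed.

Lemma sqr_l2norm d (v : 'cV[R]_d) : l2norm v ^+ 2 = dotv v v.
Proof.
rewrite sqr_sqrtr; last by apply: sumr_ge0 => j _; rewrite sqr_ge0.
by apply: eq_bigr => j _; rewrite expr2.
Qed.

Lemma l2norm_ge0 d (v : 'cV[R]_d) : 0 <= l2norm v.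
Proof. exact: sqrtr_ge0. Qed.

Lemma l2norm_eq0 d (v : 'cV[R]_d) : (l2norm v == 0) = (v == 0).
Proof. by rewrite -(sqrf_eq0 (l2norm v)) sqr_l2norm dotvv_eq0. Qed.

Lemma l2normZ d (a : R) (v : 'cV[R]_d) : l2norm (a *: v) = `|a| * l2norm v.
Proof.
apply/eqP; rewrite -(@eqrXn2 _ 2) ?mulr_ge0 ?l2norm_ge0//.
by rewrite exprMn !sqr_l2norm dotvZl dotvZr real_normK ?num_real// mulrA expr2.
Qed.

(** Expand the square of the multiple (v . v) u - (u . v) v of the component of
u orthogonal to v. *)
Lemma cauchy_schwarz_dotv d (u v : 'cV[R]_d) :
  dotv u v ^+ 2 <= dotv u u * dotv v v.
Proof.
have [->|v0] := eqVneq v 0.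
  have z0 w : dotv w (0 : 'cV[R]_d) = 0.
    by rewrite /dotv big1// => j _; rewrite mxE mulr0.
  by rewrite !z0 expr0n mulr0.
have v_gt0 : 0 < dotv v v by rewrite dotvv_gt0.
have := dotvv_ge0 (dotv v v *: u + - dotv u v *: v).
rewrite !(dotvDl, dotvDr, dotvZl, dotvZr) (dotvC v u).
rewrite [X in 0 <= X](_ : _ =
  dotv v v * (dotv u u * dotv v v - dotv u v ^+ 2)); last by ring.
by rewrite pmulr_rge0// subr_ge0.
Qed.

Lemma mulmxE_dotv m d (M : 'M[R]_(m, d)) (x : 'cV[R]_d) i :
  (M *m x) i 0 = dotv (rowv M i) x.
Proof. by rewrite mxE; apply: eq_bigr => j _; rewrite !mxE. Qed.

Lemma dotv_mulmxl m d (M : 'M[R]_(m, d)) (x : 'cV[R]_d) (y : 'cV[R]_m) :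
  dotv (M *m x) y = dotv x (M^T *m y).
Proof.
have dotE k (u v : 'cV[R]_k) : dotv u v = (u^T *m v) 0 0.
  by rewrite mxE; apply: eq_bigr => j _; rewrite mxE.
by rewrite !dotE trmx_mul mulmxA.
Qed.

Lemma sqr_frobenius_norm m d (M : 'M[R]_(m, d)) :
  frobenius_norm M ^+ 2 = \sum_i dotv (rowv M i) (rowv M i).
Proof.
rewrite sqr_sqrtr; last first.
  by apply: sumr_ge0 => i _; apply: sumr_ge0 => j _; rewrite sqr_ge0.
by apply: eq_bigr => i _; apply: eq_bigr => j _; rewrite !mxE expr2.
Qed.

(** Cauchy-Schwarz row by row.  It bounds the set whose supremum is the spectral
norm, and it also yields the lower bound on the condition number. *)
Lemma frobenius_bound m d (M : 'M[R]_(m, d)) (x : 'cV[R]_d) :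
  dotv (M *m x) (M *m x) <= frobenius_norm M ^+ 2 * dotv x x.
Proof.
rewrite sqr_frobenius_norm mulr_suml; apply: ler_sum => i _.
by rewrite mulmxE_dotv -expr2 cauchy_schwarz_dotv.
Qed.

Lemma spectral_norm_bound m d (M : 'M[R]_(m, d)) (x : 'cV[R]_d) :
  l2norm (M *m x) <= spectral_norm M * l2norm x.
Proof.
have [->|x0] := eqVneq x 0.
  have l2norm0 k : l2norm (0 : 'cV[R]_k) = 0 by apply/eqP; rewrite l2norm_eq0.
  by rewrite mulmx0 !l2norm0 mulr0.
have nx : 0 < l2norm x by rewrite lt_neqAle l2norm_ge0 eq_sym l2norm_eq0 x0.
rewrite -ler_pdivrMr// mulrC -[X in X * _]gtr0_norm ?invr_gt0// -l2normZ.
rewrite scalemxAr; apply: ub_le_sup; last first.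
  exists ((l2norm x)^-1 *: x) => //=.
  by rewrite l2normZ gtr0_norm ?invr_gt0// mulVf// gt_eqF.
exists (frobenius_norm M) => _ [y /= y1 <-].
rewrite -(@ler_pXn2r _ 2) ?nnegrE ?sqrtr_ge0// sqr_l2norm.
apply: le_trans (frobenius_bound _ _) _.
by rewrite ler_piMr ?sqr_ge0// -sqr_l2norm expr_le1// l2norm_ge0.
Qed.

(** Injectivity passes to the Gram matrix because x^T B^T B x = |B x|^2. *)
Lemma gram_unitmx m d (B : 'M[R]_(m, d)) :
  (forall x : 'cV[R]_d, B *m x = 0 -> x = 0) -> B^T *m B \in unitmx.
Proof.
move=> Binj; rewrite -row_free_unit; apply: inj_row_free => u uG.
apply: trmx_inj; rewrite trmx0; apply: Binj; apply/eqP.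
rewrite -dotvv_eq0 dotv_mulmxl.
have : (u *m (B^T *m B))^T = 0 by rewrite uG trmx0.
rewrite !trmx_mul trmxK -!mulmxA => ->.
by rewrite /dotv big1// => j _; rewrite !mxE mulr0.
Qed.

(** The squared smallest singular value of B is the inverse of the spectral norm
of the inverse Gram matrix; this form avoids any diagonalization.  Writing
w = (B^T B)^-1 z, one has |z|^2 = <B w, B z> and |B w|^2 = <w, z>, so
Cauchy-Schwarz gives |z|^4 <= <w, z> |B z|^2, while <w, z> is at most the
spectral norm times |z|^2. *)
Lemma spectral_norm_gram_inv m d (B : 'M[R]_(m, d)) (z : 'cV[R]_d) :
  B^T *m B \in unitmx ->
  dotv z z <= spectral_norm (invmx (B^T *m B)) * dotv (B *m z) (B *m z).
Proof.
move=> Gu; set s := spectral_norm _.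
have [->|z0] := eqVneq z 0.
  have d0 : dotv (0 : 'cV[R]_d) 0 = 0 by apply/eqP; rewrite dotvv_eq0.
  by rewrite dotv_mulmxl !mulmx0 d0 mulr0.
have zz : 0 < dotv z z by rewrite dotvv_gt0.
pose w := invmx (B^T *m B) *m z.
have Gw : B^T *m (B *m w) = z by rewrite mulmxA mulKVmx.
have zE : dotv z z = dotv (B *m w) (B *m z).
  by rewrite (dotvC (B *m w)) dotv_mulmxl Gw.
have wz : dotv (B *m w) (B *m w) = dotv w z by rewrite dotv_mulmxl Gw.
have wz_le : dotv w z <= s * dotv z z.
  have s_bound : l2norm w <= s * l2norm z := spectral_norm_bound _ _.
  apply: (@le_trans _ _ (l2norm w * l2norm z)); last first.
    by rewrite -sqr_l2norm expr2 mulrA ler_wpM2r ?l2norm_ge0.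
  apply: le_trans (ler_norm _) _.
  rewrite -(@ler_pXn2r _ 2) ?nnegrE ?mulr_ge0 ?l2norm_ge0//.
  by rewrite real_normK ?num_real// exprMn !sqr_l2norm cauchy_schwarz_dotv.
rewrite -(ler_pM2l zz) -expr2 {1}zE.
apply: le_trans (cauchy_schwarz_dotv _ _) _.
by rewrite wz mulrA (mulrC _ s) ler_wpM2r ?dotvv_ge0.
Qed.

End Euclidean.

(** * The row-normalized system *)

Section NormalizedSystem.
Variables (R : realType) (n d : nat) (A : 'M[R]_(n.+1, d)) (b : 'cV[R]_n.+1).
Hypothesis A_full_col_rank : \rank A = d.
Hypothesis A_rows_neq0 : forall i : 'I_n.+1, row i A != 0.

Let B := invmx (rownorm_mx A) *m A.

Lemma rownorm_neq0 i : l2norm (rowv A i) != 0.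
Proof. by rewrite l2norm_eq0 -(inj_eq (@trmx_inj _ _ _)) trmxK trmx0. Qed.

Lemma invmx_rownorm :
  invmx (rownorm_mx A) = diag_mx (\row_j (l2norm (rowv A j))^-1).
Proof.
have DD : diag_mx (\row_j (l2norm (rowv A j))^-1) *m rownorm_mx A = 1%:M.
  apply/matrixP => i j; rewrite mul_diag_mx !mxE.
  case: eqP => [_|_]; last by rewrite !mulr0n mulr0.
  by rewrite !mulr1n mulVf ?rownorm_neq0.
have [_ Du] := mulmx1_unit DD.
by rewrite -[LHS]mul1mx -DD mulmxK.
Qed.

Lemma rownorm_unitmx : rownorm_mx A \in unitmx.
Proof.
rewrite -unitmx_inv invmx_rownorm unitmxE det_diag unitfE.
by apply/prodf_neq0 => i _; rewrite mxE invr_eq0 rownorm_neq0.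
Qed.

Lemma rowv_normalized i : rowv B i = (l2norm (rowv A i))^-1 *: rowv A i.
Proof.
by apply/colP => j; rewrite /B invmx_rownorm mul_diag_mx !mxE.
Qed.

Lemma normalized_row_unit i : dotv (rowv B i) (rowv B i) = 1.
Proof.
rewrite rowv_normalized dotvZl dotvZr -sqr_l2norm.
by field; exact: rownorm_neq0.
Qed.

Lemma sqr_frobenius_normalized : frobenius_norm B ^+ 2 = n.+1%:R.
Proof.
rewrite sqr_frobenius_norm; under eq_bigr do rewrite normalized_row_unit.
by rewrite sumr_const card_ord.
Qed.

Lemma normalized_inj (x : 'cV[R]_d) : B *m x = 0 -> x = 0.
Proof.
rewrite /B -mulmxA => /(congr1 (mulmx (rownorm_mx A))).
rewrite mulKVmx ?rownorm_unitmx// mulmx0 => /(congr1 trmx).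
rewrite trmx_mul trmx0 => xA; apply: trmx_inj; rewrite trmx0.
have freeAT : row_free A^T by rewrite /row_free mxrank_tr A_full_col_rank.
by apply: (row_free_inj freeAT); rewrite xA mul0mx.
Qed.

(** A row of length 0 would vanish. *)
Lemma dim_gt0 : (0 < d)%N.
Proof.
move: (A_rows_neq0 ord0); clear; case: d A => // A' /eqP[].
by apply/rowP => -[].
Qed.

Lemma weighted_residualD x z :
  weighted_residual A b (x + z) = weighted_residual A b x + B *m z.
Proof.
by rewrite /weighted_residual /B -mulmxA -mulmxDr (mulmxDr A) addrAC.
Qed.

(** Both the scalar and the direction of a step absorb one factor of the row
norm, so the iteration on A and b is the one on the normalized system. *)
Lemma kaczmarz_stepE (c : R) i x : kaczmarz_step A b c i x =
  x - (c * weighted_residual A b x i 0) *: rowv B i.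
Proof.
rewrite /kaczmarz_step rowv_normalized scalerA -scaleNr; congr (_ + _ *: _).
rewrite /weighted_residual invmx_rownorm mul_diag_mx !mxE.
rewrite -(mulmxE_dotv A) mxE.
by field; exact: rownorm_neq0.
Qed.

Let K := cond_K B.

Lemma cond_K_bound z : dotv z z * n.+1%:R <= K * dotv (B *m z) (B *m z).
Proof.
rewrite /K /cond_K sqr_frobenius_normalized -mulrA mulrC ler_pM2l ?ltr0Sn//.
exact/spectral_norm_gram_inv/gram_unitmx/normalized_inj.
Qed.

(** With N rows, compare the lower bound N |z|^2 <= K |B z|^2 with the upper
bound |B z|^2 <= N |z|^2 at some nonzero z. *)
Lemma cond_K_ge1 : 1 <= K.
Proof.
have [z z_gt0] : exists z : 'cV[R]_d, 0 < dotv z z.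
  exists (const_mx 1); rewrite dotvv_gt0; apply/eqP => /colP/(_ (Ordinal dim_gt0)).
  by rewrite !mxE => /eqP; rewrite oner_eq0.
have hB := frobenius_bound B z; rewrite sqr_frobenius_normalized in hB.
have hK := cond_K_bound z.
have zN : 0 < dotv z z * n.+1%:R by rewrite mulr_gt0 ?ltr0Sn.
have K_gt0 : 0 < K.
  have := lt_le_trans zN hK; have := dotvv_ge0 (B *m z).
  by rewrite le_eqVlt => /predU1P[<-|w]; rewrite ?mulr0 ?ltxx// pmulr_lgt0.
rewrite -(ler_pM2r zN) mul1r; apply: le_trans hK _.
by rewrite ler_pM2l// mulrC.
Qed.

Variable xw : 'cV[R]_d.
Hypothesis xw_min : is_minimizer (weighted_ls_objective A b) xw.
Let e := weighted_residual A b xw.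

(** First-order optimality without derivatives: with p = <e, B z> and
q = |B z|^2, moving xw by t z changes the squared residual by
2 t p + t^2 q, which is negative for a suitable t unless p = 0. *)
Lemma residual_orthogonal z : dotv e (B *m z) = 0.
Proof.
set p := dotv _ _; set q := dotv (B *m z) (B *m z).
have q1_gt0 : 0 < q + 1 by rewrite ltr_wpDl ?dotvv_ge0.
(* The exact minimum is at -p / q; adding 1 keeps the denominator positive when
   B z = 0 and still makes the change negative. *)
pose t := - p / (q + 1).
have := xw_min (xw + t *: z); rewrite /weighted_ls_objective ler_pM2l//.
rewrite weighted_residualD -/e !sqr_l2norm -scalemxAr.
rewrite !(dotvDl, dotvDr, dotvZl, dotvZr) (dotvC _ e) -/p -/q -subr_ge0.
rewrite [X in 0 <= X](_ : _ = - (p ^+ 2 * ((q + 2) / (q + 1) ^+ 2))); last first.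
  by rewrite /t; field; rewrite gt_eqF.
rewrite oppr_ge0 pmulr_lle0; last first.
  by rewrite divr_gt0 ?exprn_gt0// ltr_wpDl ?dotvv_ge0.
by rewrite le_eqVlt ltNge sqr_ge0 orbF sqrf_eq0 => /eqP.
Qed.

(** The cross terms between e and B z disappear from the sum by orthogonality;
for a single index they need not. *)
Lemma sum_step_error (c : R) (x : 'cV[R]_d) :
  \sum_(i < n.+1) l2norm (kaczmarz_step A b c i x - xw) ^+ 2 =
  n.+1%:R * l2norm (x - xw) ^+ 2
  - (2 * c - c ^+ 2) * dotv (B *m (x - xw)) (B *m (x - xw))
  + c ^+ 2 * l2norm e ^+ 2.
Proof.
move: (x - xw) (subrK xw x) => z; rewrite addrC => xE.
pose s := B *m z; pose rho := e + s.
have step i : l2norm (kaczmarz_step A b c i x - xw) ^+ 2 =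
    dotv z z - 2 * c * (rho i 0 * s i 0) + c ^+ 2 * (rho i 0 * rho i 0).
  rewrite kaczmarz_stepE -xE weighted_residualD -/rho -addrA addrC addrA addrNK -scaleNr.
  rewrite sqr_l2norm !(dotvDl, dotvDr, dotvZl, dotvZr) normalized_row_unit.
  by rewrite (dotvC z) -mulmxE_dotv -/s; ring.
under eq_bigr do rewrite step.
rewrite !big_split /= sumr_const card_ord sumrN -!mulr_sumr -mulr_natl.
rewrite -/(dotv rho s) -/(dotv rho rho) !sqr_l2norm /rho.
rewrite !(dotvDl, dotvDr) (dotvC s e) residual_orthogonal -/s; ring.
Qed.

(** Subtracting a constant C with C (1 - q) at least the mean noise c^2 r_w turns
the affine recursion for the mean squared error into a contraction, so no
geometric series has to be summed.  The value of C in the theorem makes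
C (1 - q) twice the noise. *)
Lemma mean_step_contraction (c C : R) (x : 'cV[R]_d) : 0 < c -> c < 1 ->
  C = c / (1 - c) * K * (l2norm e ^+ 2 / n.+1%:R) ->
  \sum_(i < n.+1) (l2norm (kaczmarz_step A b c i x - xw) ^+ 2 - C)
  <= n.+1%:R * ((1 - 2 * c * (1 - c) / K) * (l2norm (x - xw) ^+ 2 - C)).
Proof.
move=> c0 c1 CE.
have K_gt0 : 0 < K by apply: lt_le_trans cond_K_ge1.
have N_gt0 : 0 < n.+1%:R :> R by rewrite ltr0Sn.
have c1' : 0 < 1 - c by rewrite subr_gt0.
rewrite big_split /= sum_step_error sumr_const card_ord mulNrn -[C *+ _]mulr_natl.
move: (x - xw) => z; rewrite [l2norm z ^+ 2]sqr_l2norm.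
set p := 2 * c * (1 - c) / K; set V := dotv z z; set W := dotv _ _.
set E := l2norm e ^+ 2; set N := n.+1%:R in CE *.
have pNV : p * (V * N) <= 2 * c * (1 - c) * W.
  have p_ge0 : 0 <= p by rewrite ltW// divr_gt0// !mulr_gt0.
  apply: le_trans (ler_wpM2l p_ge0 (cond_K_bound z)) _.
  by rewrite mulrA divfK ?gt_eqF.
have pNC : p * C * N = 2 * c ^+ 2 * E.
  have cancel (k m E' : R) : k != 0 -> m != 0 ->
    2 * c * (1 - c) / k * (c / (1 - c) * k * (E' / m)) * m = 2 * c ^+ 2 * E'.
    by move=> k0 m0; field; rewrite k0 m0 gt_eqF.
  by rewrite /p CE cancel// gt_eqF.
have W_ge0 : 0 <= c ^+ 2 * W by rewrite mulr_ge0 ?sqr_ge0 ?dotvv_ge0.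
have E_ge0 : 0 <= c ^+ 2 * E by rewrite mulr_ge0 ?sqr_ge0.
rewrite -subr_ge0 [X in 0 <= X](_ : _ = (2 * c * (1 - c) * W - p * (V * N))
  + c ^+ 2 * W + (p * C * N - 2 * c ^+ 2 * E) + c ^+ 2 * E); last by ring.
rewrite pNC subrr addr0; apply: addr_ge0 => //; apply: addr_ge0 => //.
by rewrite subr_ge0.
Qed.

End NormalizedSystem.

(** * Averages over sequences of row indices *)

Lemma eq_kaczmarz (R : realType) (n d : nat) (A : 'M[R]_(n, d)) b c x0
    (s t : nat -> 'I_n) k : (forall j, (j < k)%N -> s j = t j) ->
  kaczmarz A b c x0 s k = kaczmarz A b c x0 t k.
Proof.
elim: k => //= k IH st; rewrite st// IH// => j jk.
by apply: st; rewrite ltnS ltnW.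
Qed.

Lemma kaczmarzSr (R : realType) (n d : nat) (A : 'M[R]_(n, d)) b c x0
    (s : nat -> 'I_n) k : kaczmarz A b c x0 s k.+1 =
  kaczmarz A b c (kaczmarz_step A b c (s 0%N) x0) (fun j => s j.+1) k.
Proof. by elim: k => //= k ->. Qed.

Lemma big_tupleS (V : nmodType) (T : finType) k (F : k.+1.-tuple T -> V) :
  \sum_t F t = \sum_i \sum_(t : k.-tuple T) F [tuple of i :: t].
Proof.
rewrite pair_big /=.
rewrite (reindex (fun p : T * k.-tuple T => [tuple of p.1 :: p.2])) //=.
exists (fun t : k.+1.-tuple T => (thead t, [tuple of behead t])).
  by move=> [i t] _ /=; congr pair; apply: val_inj.
by move=> t _; rewrite [RHS]tuple_eta.
Qed.

(** Induction on k for all starting points at once: a tuple is split into its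
first index, which moves the starting point, and the remaining draws.  The
function g may take negative values, as it does in the application. *)
Lemma sum_kaczmarz_contraction (R : realType) (n d : nat)
    (A : 'M[R]_(n.+1, d)) b c (g : 'cV[R]_d -> R) (q : R) k x0 : 0 <= q ->
  (forall x, \sum_i g (kaczmarz_step A b c i x) <= n.+1%:R * (q * g x)) ->
  \sum_(t : k.-tuple 'I_n.+1) g (kaczmarz A b c x0 (nth ord0 t) k)
  <= n.+1%:R ^+ k * (q ^+ k * g x0).
Proof.
move=> q0 gq; elim: k x0 => [|k IH] x0.
  by rewrite /= sumr_const card_tuple expn0 mulr1n !mul1r.
rewrite big_tupleS.
under eq_bigr do under eq_bigr do rewrite kaczmarzSr/=.
apply: le_trans (ler_sum _ (fun i _ => IH _)) _.
rewrite -!mulr_sumr !exprSr -!mulrA ler_wpM2l ?exprn_ge0//.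
by rewrite mulrCA ler_wpM2l ?exprn_ge0.
Qed.

(** * Expectations over independent uniform draws *)

Section UniformSampling.
Variables (R : realType) (n : nat) (disp : measure_display)
  (Omega : measurableType disp) (P : probability Omega R)
  (idx : nat -> {RV P >-> 'I_n.+1}).
Hypothesis idx_indep : mutually_independent idx.
Hypothesis idx_unif : forall j : nat, uniformly_distributed (idx j).

Let hist k (w : Omega) : k.-tuple 'I_n.+1 := [tuple idx j w | j < k].

(** Puts the event that the first k draws are t in the form to which mutual
independence applies. *)
Lemma hist_preimageE k (t : k.-tuple 'I_n.+1) :
  hist k @^-1` [set t] =
  \bigcap_(j in [set` [fset j in iota 0 k]%fset]) (idx j @^-1` [set nth ord0 t j]).
Proof.
apply/seteqP; split => w /=.
  move=> <- j; rewrite /= !inE mem_iota add0n => /= jk.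
  by rewrite -[RHS](tnth_nth ord0 (hist k w) (Ordinal jk)) tnth_mktuple.
move=> H; apply: eq_from_tnth => j; rewrite tnth_mktuple (tnth_nth ord0).
by apply: H; rewrite /= !inE mem_iota /=.
Qed.

Lemma measurable_hist_preimage k (t : k.-tuple 'I_n.+1) :
  measurable (hist k @^-1` [set t]).
Proof.
rewrite hist_preimageE; apply: bigcap_measurableType => j _.
by apply: measurable_funPTI.
Qed.

Lemma prob_hist k (t : k.-tuple 'I_n.+1) :
  P (hist k @^-1` [set t]) = ((n.+1%:R ^+ k)^-1)%:E.
Proof.
rewrite hist_preimageE idx_indep//.
under eq_bigr do rewrite idx_unif.
rewrite prodEFin big_const_seq count_predT iter_mulr_1 exprVn.
by rewrite card_fseq undup_id ?iota_uniq// size_iota.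
Qed.

(** The integrand is a finite combination of indicators of the equally likely
events on which the first k draws are a given tuple. *)
Lemma expectation_hist k (F : k.-tuple 'I_n.+1 -> R) : (forall t, 0 <= F t) ->
  'E_P[fun w => F (hist k w)]%E = ((n.+1%:R ^+ k)^-1 * \sum_t F t)%:E.
Proof.
move=> F0; rewrite unlock.
have FE w : (F (hist k w))%:E =
    (\sum_t (F t)%:E * (\1_(hist k @^-1` [set t]) w)%:E)%E.
  rewrite (bigD1 (hist k w))//= big1 ?adde0 => [|t /eqP tw].
    by rewrite indicE mem_set// mule1.
  by rewrite indicE memNset ?mule0// => /= /esym.
under eq_integral do rewrite FE.
have mind t : measurable_fun [set: Omega]
    (EFin \o (\1_(hist k @^-1` [set t]) : Omega -> R)).
  apply/measurable_EFinP; apply: measurable_indic.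
  exact: measurable_hist_preimage.
rewrite ge0_integral_sum//=; last 2 first.
- by move=> t; exact: (measurable_funeM _ (mind t)).
- by move=> t w _; rewrite mule_ge0// lee_fin.
rewrite mulr_sumr -sumEFin; apply: eq_bigr => t _.
rewrite (ge0_integralZl_EFin _ measurableT _ (mind t))//; last first.
  by move=> w _; rewrite lee_fin.
rewrite integral_indic//; last exact: measurable_hist_preimage.
by rewrite setIT [X in (_ * X)%E](prob_hist t) -EFinM mulrC.
Qed.

End UniformSampling.

Theorem corollary5p2 (R : realType) (n d : nat)
    (A : 'M[R]_(n.+1, d)) (b : 'cV[R]_n.+1)
    (A_full_col_rank : \rank A = d)
    (A_rows_neq0 : forall i : 'I_n.+1, row i A != 0)
    (xw : 'cV[R]_d)
    (xw_min : is_minimizer (weighted_ls_objective A b) xw)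
    (c : R) (c_gt0 : 0 < c) (c_lt1 : c < 1)
    (x0 : 'cV[R]_d)
    (disp : measure_display) (Omega : measurableType disp)
    (P : probability Omega R)
    (idx : nat -> {RV P >-> 'I_n.+1})
    (idx_indep : mutually_independent idx)
    (idx_unif : forall j : nat, uniformly_distributed (idx j))
    (k : nat) :
  let K := cond_K (invmx (rownorm_mx A) *m A) in
  let e_w := weighted_residual A b xw in
  let r_w := l2norm e_w ^+ 2 / n.+1%:R in
  ('E_P[fun w =>
       (l2norm (kaczmarz A b c x0 (fun j => idx j w) k - xw) ^+ 2)%R]
   <= ((1 - 2 * c * (1 - c) / K) ^+ k * l2norm (x0 - xw) ^+ 2
       + c / (1 - c) * K * r_w)%R%:E)%E.
Proof.
(* The let-bound abbreviations sit under the coercion of the boolean inequality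
   to a proposition and cannot be introduced directly. *)
cbv zeta; set K := cond_K _; set r_w := _ / n.+1%:R.
have K_ge1 : 1 <= K by apply: cond_K_ge1.
have K_gt0 : 0 < K by apply: lt_le_trans K_ge1.
set q := 1 - _; set C := c / (1 - c) * K * r_w.
have C_ge0 : 0 <= C.
  apply: mulr_ge0; last by rewrite divr_ge0 ?sqr_ge0.
  by rewrite ltW// mulr_gt0// divr_gt0// subr_gt0.
have q_ge0 : 0 <= q.
  rewrite /q subr_ge0 ler_pdivrMr// mul1r; apply: le_trans K_ge1.
  (* 2 c (1 - c) <= 1, since 2 - 4 c (1 - c) = (1 - 2 c)^2 + 1. *)
  have : 0 <= (1 - 2 * c) ^+ 2 + 1 by rewrite addr_ge0 ?sqr_ge0.
  by rewrite -subr_ge0 => ?; lra.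
pose V x := l2norm (x - xw) ^+ 2.
pose F (t : k.-tuple 'I_n.+1) := V (kaczmarz A b c x0 (nth ord0 t) k).
have kE w : kaczmarz A b c x0 (fun j => idx j w) k =
    kaczmarz A b c x0 (nth ord0 [tuple idx j w | j < k]) k.
  apply: eq_kaczmarz => j jk.
  rewrite -[RHS](tnth_nth ord0 [tuple idx j w | j < k] (Ordinal jk)).
  by rewrite tnth_mktuple.
under [X in 'E_P[X]%E]eq_fun do rewrite kE.
rewrite (expectation_hist idx_indep idx_unif (F := F)); last first.
  by move=> t; rewrite sqr_ge0.
rewrite lee_fin mulrC ler_pdivrMr ?exprn_gt0 ?ltr0Sn//.
have step x := mean_step_contraction A_full_col_rank A_rows_neq0 xw_min x
  c_gt0 c_lt1 (erefl C).
(* The constant C is subtracted from every term of the sum over tuples. *)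
have := sum_kaczmarz_contraction k x0 q_ge0 step.
rewrite big_split /= sumr_const card_tuple card_ord mulNrn lerBlDr.
move=> /le_trans; apply.
rewrite -[C *+ _]mulr_natr natrX -/(V x0).
set N := _ ^+ k.
rewrite [leRHS]mulrC (mulrC C) -mulrDr ler_wpM2l ?exprn_ge0//.
by rewrite mulrBr -addrA lerD2l addrC gerBl// mulr_ge0 ?exprn_ge0.
Qed.
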